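(* Up to isomorphism there are only two two-dimensional complex symmetric Leibniz algebras with nonzero multiplication, given on a basis $\{e_1,e_2\}$ (only nonzero products listed, up to antisymmetry in the Lie case) by: the Lie algebra $[e_1,e_2]=e_2$ (with $[e_2,e_1]=-e_2$), and the non-Lie algebra $[e_1,e_1]=e_2$. If $\mathbb{C}^2$ is endowed with the Hermitian inner product $\langle\cdot,\cdot\rangle$ for which $\{e_1,e_2\}$ is an orthonormal basis, then the Lie algebra is a critical point of $F_2$ with type $(0<1;1,1)$ and critical value $4$, and the non-Lie symmetric Leibniz algebra is a critical point of $F_2$ with type $(1<2;1,1)$ and critical value $20$.
   Context: Let $V_n=\otimes^2(\mathbb{C}^n)^*\otimes\mathbb{C}^n$ be the space of all bilinear maps $\mu:\mathbb{C}^n\times\mathbb{C}^n\to\mathbb{C}^n$. $\mathrm{GL}(n)$ acts on $V_n$ by $g.\mu(X,Y)=g\mu(g^{-1}X,g^{-1}Y)$, and $\mathrm{Der}(\mu)$ is the derivation algebra of $\mu$. A Hermitian inner product on $\mathbb{C}^n$ induces the Hermitian inner product $\langle\mu,\lambda\rangle=\sum_{i,j,k}\langle\mu(X_i,X_j),X_k\rangle\overline{\langle\lambda(X_i,X_j),X_k\rangle}$ on $V_n$, where $\{X_i\}$ is any orthonormal basis of $\mathbb{C}^n$. On $\mathfrak{gl}(n)$ put $(A,B)=\operatorname{tr}AB^*$, where $^*$ is the conjugate transpose with respect to the inner product; $\mathrm{i}\mathfrak{u}(n)$ is the space of Hermitian operators. The moment map $m:\mathbb{P}V_n\to\mathrm{i}\mathfrak{u}(n)$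 is defined by $(m([\mu]),A)=(\mathrm{d}\rho_\mu)_eA/\|\mu\|^2$ for $A\in\mathrm{i}\mathfrak{u}(n)$, where $\rho_\mu(g)=\langle g.\mu,g.\mu\rangle$, and $F_n([\mu])=\|m([\mu])\|^2=(m([\mu]),m([\mu]))$. With $L^\mu_X(Y)=\mu(X,Y)$, $R^\mu_X(Y)=\mu(Y,X)$, set $\mathrm{M}_\mu=2\sum_iL^\mu_{X_i}(L^\mu_{X_i})^*-2\sum_i(L^\mu_{X_i})^*L^\mu_{X_i}-2\sum_i(R^\mu_{X_i})^*R^\mu_{X_i}$; one has $m([\mu])=\mathrm{M}_\mu/\|\mu\|^2$. It is known that $[\mu]$ is a critical point of $F_n:\mathbb{P}V_n\to\mathbb{R}$ iff $\mathrm{M}_\mu=c_\mu I+D_\mu$ with $c_\mu\in\mathbb{R}$, $D_\mu\in\mathrm{Der}(\mu)$. Type: for a critical point $[\mu]$ with $\mathrm{M}_\mu=c_\mu I+D_\mu$ there is a constant $c>0$ such that the eigenvalues of $cD_\mu$ are integers $k_1<\cdots<k_r$ prime to each other, with multiplicities $d_1,\dots,d_r$; the data $(k_1<\cdots<k_r;d_1,\dots,d_r)$ is the type of $[\mu]$. The critical value is $F_n([\mu])$. A symmetric Leibniz algebra is an algebra satisfying $x(yz)=(xy)z+y(xz)$ and $(xy)z=(xz)y+x(yz)$ for all $x,y,z$ (here the product $xy$ is written $[x,y]$). *)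

(* Defs.v *)
From HB Require Import structures.
From mathcomp Require Import all_boot all_order all_algebra.
From mathcomp Require Import complex.
From mathcomp Require Import all_classical all_reals all_analysis.

Set Implicit Arguments.
Unset Strict Implicit.
Unset Printing Implicit Defensive.

Import Order.TTheory GRing.Theory Num.Theory.
Import numFieldNormedType.Exports.

Local Open Scope classical_set_scope.
Local Open Scope complex_scope.
Local Open Scope ring_scope.

(* The space V_n of bilinear maps on C^n = 'cV[R[i]]_n, a bilinear map mu being
   recorded by its values mu (i, j) on pairs of standard basis vectors; the
   bilinear map itself is [bmul mu]. Endomorphisms act on column vectors by left
   multiplication. *)
Notation bilin R n := {ffun 'I_n * 'I_n -> 'cV[R[i]]_n}.

Section Algebras.
Variables (R : realType) (n : nat).
Implicit Types (mu lam : bilin R n) (x y z : 'cV[R[i]]_n) (g D : 'M[R[i]]_n).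

Definition bmul mu x y : 'cV[R[i]]_n :=
  \sum_i \sum_j (x i 0 * y j 0) *: mu (i, j).

Definition symmetric_leibniz mu : Prop := forall x y z,
  bmul mu x (bmul mu y z) = bmul mu (bmul mu x y) z + bmul mu y (bmul mu x z) /\
  bmul mu (bmul mu x y) z = bmul mu (bmul mu x z) y + bmul mu x (bmul mu y z).

Definition lie_algebra mu : Prop :=
  (forall x, bmul mu x x = 0) /\
  (forall x y z, bmul mu x (bmul mu y z) + bmul mu y (bmul mu z x)
                 + bmul mu z (bmul mu x y) = 0).

Definition isomorphic mu lam : Prop :=
  exists2 g, g \in unitmx &
    forall x y, g *m bmul mu x y = bmul lam (g *m x) (g *m y).

Definition derivation mu D : Prop :=
  forall x y, D *m bmul mu x y = bmul mu (D *m x) y + bmul mu x (D *m y).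

Definition act g mu : bilin R n :=
  [ffun ij => g *m bmul mu (invmx g *m delta_mx ij.1 0)
                          (invmx g *m delta_mx ij.2 0)].

Definition Lmul mu x : 'M[R[i]]_n := \matrix_(k, j) bmul mu x (delta_mx j 0) k 0.
Definition Rmul mu x : 'M[R[i]]_n := \matrix_(k, j) bmul mu (delta_mx j 0) x k 0.

(* The point [mu] of P(V_n), as the complex line spanned by mu (for mu != 0). *)
Definition pt mu : set (bilin R n) := [set a *: mu | a in [set: R[i]]].

End Algebras.

(* A Hermitian inner product on C^n is given by an invertible matrix E: it is the
   one for which the columns of E form an orthonormal basis. Every Hermitian
   inner product is of this form. *)
Section Hermitian.
Variables (R : realType) (n : nat) (E : 'M[R[i]]_n).
Implicit Types (mu lam : bilin R n) (x y : 'cV[R[i]]_n) (g A B H D : 'M[R[i]]_n).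

Definition hdot x y : R[i] :=
  \sum_k (invmx E *m x) k 0 * ((invmx E *m y) k 0)^*.

(* The adjoint for hdot: hdot (A *m x) y = hdot x (adj A *m y). *)
Definition adj A : 'M[R[i]]_n :=
  E *m (map_mx Num.conj (invmx E *m A *m E))^T *m invmx E.

Definition hermitian A : Prop := adj A = A.

Definition mxdot A B : R[i] := \tr (A *m adj B).

Definition bdot mu lam : R[i] :=
  \sum_i \sum_j \sum_k
    hdot (bmul mu (col i E) (col j E)) (col k E) *
    (hdot (bmul lam (col i E) (col j E)) (col k E))^*.

(* bdot mu mu and mxdot H H are real; Re only changes the type. *)
Definition sqnorm mu : R := complex.Re (bdot mu mu).

Definition rho mu g : R := sqnorm (act g mu).

(* The differential of [rho mu] at the identity, along the curve 1 + t A, which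
   lies in GL(n) for t near 0. *)
Definition drho mu A : R :=
  derive1 (fun t : R => rho mu (1%:M + t%:C *: A)) 0.

Definition moment_map (p : set (bilin R n)) : 'M[R[i]]_n :=
  xget 0 [set H | hermitian H /\
    forall mu, mu != 0 -> p = pt mu ->
      forall A, hermitian A -> mxdot H A = (drho mu A / sqnorm mu)%:C].

Definition Fn (p : set (bilin R n)) : R :=
  complex.Re (mxdot (moment_map p) (moment_map p)).

(* [mu] is a critical point of Fn on P(V_n). The tangent vectors of P(V_n) at
   [mu] are the velocities at t = 0 of the curves t |-> [mu + t lam]. *)
Definition critical_point mu : Prop :=
  mu != 0 /\
  forall lam, is_derive (0 : R) 1 (fun t : R => Fn (pt (mu + t%:C *: lam))) 0.

Definition Mmx mu : 'M[R[i]]_n :=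
  2 *: (\sum_i Lmul mu (col i E) *m adj (Lmul mu (col i E)))
  - 2 *: (\sum_i adj (Lmul mu (col i E)) *m Lmul mu (col i E))
  - 2 *: (\sum_i adj (Rmul mu (col i E)) *m Rmul mu (col i E)).

(* The critical point [mu] has type (k_1 < ... < k_r; d_1, ..., d_r). The gcd of
   the k_i is 1, or 0 in the degenerate case D = 0 of type (0; n). *)
Definition has_type mu (ks : seq int) (ds : seq nat) : Prop :=
  critical_point mu /\
  exists (c : R) (D : 'M[R[i]]_n) (a : R),
    [/\ Mmx mu = (c%:C)%:M + D, derivation mu D, 0 < a &
     [/\ size ks = size ds, sorted <%R ks, all (leq 1) ds,
         \big[gcdz/0]_(k <- ks) k <= 1 &
         char_poly (a%:C *: D) =
           \prod_(kd <- zip ks ds) ('X - (kd.1%:~R)%:P) ^+ kd.2]].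

End Hermitian.

(* Main.v *)
Require Import Defs.
From HB Require Import structures.
From mathcomp Require Import all_boot all_order all_algebra.
From mathcomp Require Import complex ring.
From mathcomp Require Import all_classical all_reals all_analysis.

Set Implicit Arguments.
Unset Strict Implicit.
Unset Printing Implicit Defensive.

Import Order.TTheory GRing.Theory Num.Theory.
Import numFieldNormedType.Exports.

Local Open Scope ring_scope.

(* For Hermitian A the moment map satisfies (m([mu]), A) = 2 Re <A.mu, mu> / |mu|^2,
   and \tr (M_mu A) = 2 <A.mu, mu> identifies it with M_mu / |mu|^2.  The sesquilinear
   polarization M(mu, lam) obeys \tr (M(mu, lam) A) = 2 <A.mu, lam>.  If M_mu = c I + D
   with D a derivation, then M_mu.mu = - c mu, so that \tr (M_mu^2) = - 2 c |mu|^2 and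
   the derivative of \tr (M^2) along lam is - 8 c Re <mu, lam>: the derivative of
   \tr (M^2) / |mu|^4 vanishes and the critical value is - 2 c / |mu|^2.
   For the classification, in a symmetric Leibniz algebra y = xx satisfies
   xy = yx = yy = 0; if some y is nonzero then (x, y) is a basis giving the nilpotent
   algebra, and otherwise the product is alternating, hence xy = det(x, y) w. *)

(** Entry rules for the vector space operations only, so that matrix products and values of [bmul]
    stay atoms for [ring] in [mxring]. *)
Lemma mx_linE (R : pzRingType) m n :
  (forall (A B : 'M[R]_(m, n)) i j, (A + B) i j = A i j + B i j) *
  (forall (A : 'M[R]_(m, n)) i j, (- A) i j = - A i j) *
  (forall (a : R) (A : 'M[R]_(m, n)) i j, (a *: A) i j = a * A i j) *
  (forall i j, (0 : 'M[R]_(m, n)) i j = 0).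
Proof. by do ![split] => *; rewrite mxE. Qed.

Ltac mxring := apply/matrixP => ? ?; rewrite !mx_linE; ring.

(** * Bilinear maps and the matrices acting on them *)

Section Bilinear.
Variables (R : realType) (n : nat).
Implicit Types (a : R[i]) (mu lam : bilin R n) (x y z : 'cV[R[i]]_n) (g A B C D : 'M[R[i]]_n).

Lemma cV_delta x : x = \sum_i x i 0 *: delta_mx i 0.
Proof.
rewrite {1}[x]matrix_sum_delta; apply: eq_bigr => i _.
by rewrite big_ord1.
Qed.

Lemma bmul_deltar mu x j : bmul mu x (delta_mx j 0) = \sum_i x i 0 *: mu (i, j).
Proof.
apply: eq_bigr => i _; rewrite (bigD1 j) //= big1 ?addr0 => [|k kj].
  by rewrite mxE !eqxx mulr1.
by rewrite mxE (negbTE kj) mulr0 scale0r.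
Qed.

Lemma bmul_deltal mu i y : bmul mu (delta_mx i 0) y = \sum_j y j 0 *: mu (i, j).
Proof.
rewrite /bmul (bigD1 i) //= [X in _ + X]big1 ?addr0 => [|k ki].
  by apply: eq_bigr => j _; rewrite mxE !eqxx mul1r.
by rewrite big1 // => j _; rewrite mxE (negbTE ki) mul0r scale0r.
Qed.

Lemma bmul_delta mu i j : bmul mu (delta_mx i 0) (delta_mx j 0) = mu (i, j).
Proof.
rewrite bmul_deltal (bigD1 j) //= big1 ?addr0 => [|k kj].
  by rewrite mxE !eqxx scale1r.
by rewrite mxE (negbTE kj) scale0r.
Qed.

Lemma mul_Lmul mu x y : Lmul mu x *m y = bmul mu x y.
Proof.
apply/matrixP => k l; rewrite [l]ord1 !mxE /bmul exchange_big /= summxE.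
apply: eq_bigr => j _; rewrite mxE bmul_deltar !summxE mulr_suml.
by apply: eq_bigr => i _; rewrite !mxE mulrAC.
Qed.

Lemma mul_Rmul mu x y : Rmul mu y *m x = bmul mu x y.
Proof.
apply/matrixP => k l; rewrite [l]ord1 !mxE /bmul summxE.
apply: eq_bigr => i _; rewrite mxE bmul_deltal !summxE mulr_suml.
by apply: eq_bigr => j _; rewrite !mxE mulrAC [y j 0 * _]mulrC.
Qed.

Lemma bmulDr mu x y z : bmul mu x (y + z) = bmul mu x y + bmul mu x z.
Proof. by rewrite -!mul_Lmul mulmxDr. Qed.

Lemma bmulDl mu x y z : bmul mu (x + y) z = bmul mu x z + bmul mu y z.
Proof. by rewrite -!mul_Rmul mulmxDr. Qed.

Lemma bmul0r mu x : bmul mu x 0 = 0.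
Proof. by rewrite -mul_Lmul mulmx0. Qed.

Lemma bmul0l mu y : bmul mu 0 y = 0.
Proof. by rewrite -mul_Rmul mulmx0. Qed.

Lemma bmulZr mu a x y : bmul mu x (a *: y) = a *: bmul mu x y.
Proof. by rewrite -!mul_Lmul scalemxAr. Qed.

Lemma bmulZl mu a x y : bmul mu (a *: x) y = a *: bmul mu x y.
Proof. by rewrite -!mul_Rmul scalemxAr. Qed.

Lemma bmul_sumr mu x (I : finType) (F : I -> 'cV[R[i]]_n) :
  bmul mu x (\sum_i F i) = \sum_i bmul mu x (F i).
Proof. by rewrite -mul_Lmul mulmx_sumr; under eq_bigr do rewrite mul_Lmul. Qed.

Lemma bmul_suml mu y (I : finType) (F : I -> 'cV[R[i]]_n) :
  bmul mu (\sum_i F i) y = \sum_i bmul mu (F i) y.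
Proof. by rewrite -mul_Rmul mulmx_sumr; under eq_bigr do rewrite mul_Rmul. Qed.

Lemma cV_col (E : 'M[R[i]]_n) x :
  E \in unitmx -> x = \sum_i (invmx E *m x) i 0 *: col i E.
Proof.
move=> Eu; rewrite -{1}[x](mulKVmx Eu) {1}[invmx E *m x]cV_delta mulmx_sumr.
by apply: eq_bigr => i _; rewrite -scalemxAr colE.
Qed.

Lemma bmulDf mu lam x y : bmul (mu + lam) x y = bmul mu x y + bmul lam x y.
Proof.
rewrite -big_split; apply: eq_bigr => i _; rewrite -big_split.
by apply: eq_bigr => j _; rewrite ffunE scalerDr.
Qed.

Lemma bmulZf a mu x y : bmul (a *: mu) x y = a *: bmul mu x y.
Proof.
rewrite scaler_sumr; apply: eq_bigr => i _; rewrite scaler_sumr.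
by apply: eq_bigr => j _; rewrite ffunE !scalerA mulrC.
Qed.

Lemma linear_deltaE (f : 'cV[R[i]]_n -> 'cV[R[i]]_n) x :
  linear f -> f x = \sum_i x i 0 *: f (delta_mx i 0).
Proof.
move=> lf; pose F := GRing.isLinear.Build _ _ _ _ f lf.
pose g : {linear 'cV[R[i]]_n -> 'cV[R[i]]_n} := HB.pack f F.
rewrite {1}[x]cV_delta [LHS](linear_sum g).
by apply: eq_bigr => i _; rewrite linearZ_LR.
Qed.

Lemma bmul0f x y : bmul (0 : bilin R n) x y = 0.
Proof. by rewrite -(scale0r (0 : bilin R n)) bmulZf scale0r. Qed.

(** Expanding both arguments in the standard basis reduces the claim to basis vectors. Products
    defined by a formula on basis vectors are thereby evaluated on arbitrary ones. *)
Lemma bmul_ffun (f : 'cV[R[i]]_n -> 'cV[R[i]]_n -> 'cV[R[i]]_n) x y :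
    (forall u, linear (f u)) -> (forall v, linear (f^~ v)) ->
  bmul [ffun ij => f (delta_mx ij.1 0) (delta_mx ij.2 0)] x y = f x y.
Proof.
move=> fr fl; rewrite [RHS](linear_deltaE x (fl y)); apply: eq_bigr => i _ /=.
rewrite (linear_deltaE y (fr _)) scaler_sumr; apply: eq_bigr => j _.
by rewrite scalerA ffunE.
Qed.

Lemma bilinP mu lam : (forall x y, bmul mu x y = bmul lam x y) <-> mu = lam.
Proof.
split=> [h|-> //]; apply/ffunP => -[i j]; by rewrite -!bmul_delta h.
Qed.

Lemma bmul_act g mu x y :
  bmul (act g mu) x y = g *m bmul mu (invmx g *m x) (invmx g *m y).
Proof.
apply: (bmul_ffun (f := fun x y => g *m bmul mu (invmx g *m x) (invmx g *m y))).
  by move=> u a v w; rewrite linearP /= bmulDr bmulZr linearP.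
by move=> u a v w; rewrite linearP /= bmulDl bmulZl linearP.
Qed.

(** Independent matrices in the output and the two inputs give the terms of degree two and three
    when [act (1%:M + a *: A) mu] is expanded in [a]. *)
Definition tact A B C mu : bilin R n :=
  [ffun ij => A *m bmul mu (B *m delta_mx ij.1 0) (C *m delta_mx ij.2 0)].

Lemma bmul_tact A B C mu x y :
  bmul (tact A B C mu) x y = A *m bmul mu (B *m x) (C *m y).
Proof.
apply: (bmul_ffun (f := fun x y => A *m bmul mu (B *m x) (C *m y))).
  by move=> u a v w; rewrite linearP /= bmulDr bmulZr linearP.
by move=> u a v w; rewrite linearP /= bmulDl bmulZl linearP.
Qed.

(* The infinitesimal action of gl(n): the differential of g |-> g.mu at 1. *)
Definition ract A mu : bilin R n :=
  [ffun ij => A *m bmul mu (delta_mx ij.1 0) (delta_mx ij.2 0)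
     - bmul mu (A *m delta_mx ij.1 0) (delta_mx ij.2 0)
     - bmul mu (delta_mx ij.1 0) (A *m delta_mx ij.2 0)].

Lemma bmul_ract A mu x y :
  bmul (ract A mu) x y = A *m bmul mu x y - bmul mu (A *m x) y - bmul mu x (A *m y).
Proof.
apply: (bmul_ffun (f := fun x y =>
  A *m bmul mu x y - bmul mu (A *m x) y - bmul mu x (A *m y))) => u a v w.
  by rewrite !(linearP, bmulDr, bmulZr) /=; mxring.
by rewrite !(linearP, bmulDl, bmulZl) /=; mxring.
Qed.

Lemma ractD A mu lam : ract A (mu + lam) = ract A mu + ract A lam.
Proof.
by apply/bilinP => x y; rewrite bmulDf !bmul_ract !bmulDf mulmxDr; mxring.
Qed.

Lemma ractZ A a mu : ract A (a *: mu) = a *: ract A mu.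
Proof.
by apply/bilinP => x y; rewrite bmulZf !bmul_ract !bmulZf -scalemxAr; mxring.
Qed.

(** A scalar [c] acts by c mu - c mu - c mu = - c mu, while a derivation acts by zero. *)
Lemma ract_derivation (c : R[i]) D mu :
  derivation mu D -> ract (c%:M + D) mu = - c *: mu.
Proof.
move=> dD; apply/bilinP => x y; rewrite bmul_ract bmulZf !mulmxDl dD !mul_scalar_mx.
by rewrite bmulDl bmulDr bmulZl bmulZr; mxring.
Qed.

End Bilinear.

Lemma isomorphic_act (R : realType) n (g : 'M[R[i]]_n) (mu : bilin R n) :
  g \in unitmx -> isomorphic mu (act g mu).
Proof. by move=> gu; exists g => // x y; rewrite bmul_act !mulKmx. Qed.

(* The sesquilinear polarization of [mu |-> Mmx E mu]. *)
HB.lock Definition Mpol (R : realType) n (E : 'M[R[i]]_n) (mu lam : bilin R n) :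
    'M[R[i]]_n :=
  2 *: \sum_i (Lmul mu (col i E) *m adj E (Lmul lam (col i E))
               - adj E (Lmul lam (col i E)) *m Lmul mu (col i E)
               - adj E (Rmul lam (col i E)) *m Rmul mu (col i E)).

(** * Adjoints and inner products in an orthonormal basis, and the trace formula for [Mpol] *)

Section HermitianGeometry.
Variables (R : realType) (n : nat) (E : 'M[R[i]]_n).
Hypothesis Eu : E \in unitmx.
Implicit Types (a : R[i]) (mu lam nu : bilin R n) (x y : 'cV[R[i]]_n) (A B C D : 'M[R[i]]_n).

(* Structure constants of mu and matrix of A in the orthonormal basis [col i E]. *)
Let str mu i j k : R[i] := (invmx E *m bmul mu (col i E) (col j E)) k 0.
Let emx A := invmx E *m A *m E.

Lemma hdot_colE x k : hdot E x (col k E) = (invmx E *m x) k 0.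
Proof.
have colK l : (invmx E *m col k E) l 0 = (l == k)%:R.
  by rewrite colE mulKmx // mxE eqxx andbT.
rewrite /hdot (bigD1 k) //= big1 => [|l lk]; rewrite colK.
  by rewrite eqxx rmorph1 mulr1 addr0.
by rewrite (negbTE lk) rmorph0 mulr0.
Qed.

Lemma bdotE mu lam :
  bdot E mu lam = \sum_i \sum_j \sum_k str mu i j k * (str lam i j k)^*.
Proof. by do 3!apply: eq_bigr => ? _; rewrite !hdot_colE. Qed.

Lemma bdotDl mu nu lam : bdot E (mu + nu) lam = bdot E mu lam + bdot E nu lam.
Proof.
rewrite !bdotE; do 3!(rewrite -big_split; apply: eq_bigr => ? _ /=).
by rewrite /str bmulDf mulmxDr mxE mulrDl.
Qed.

Lemma bdotZl a mu lam : bdot E (a *: mu) lam = a * bdot E mu lam.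
Proof.
rewrite !bdotE; do 3!(rewrite mulr_sumr; apply: eq_bigr => ? _ /=).
by rewrite /str bmulZf -scalemxAr mxE mulrA.
Qed.

Lemma bdotC mu lam : bdot E lam mu = (bdot E mu lam)^*.
Proof.
rewrite !bdotE; do 3!(rewrite rmorph_sum; apply: eq_bigr => ? _ /=).
by rewrite rmorphM /= conjCK mulrC.
Qed.

Lemma bdot_ge0 mu : 0 <= bdot E mu mu.
Proof. by rewrite bdotE; do 3!apply: sumr_ge0 => ? _; exact: mul_conjC_ge0. Qed.

Lemma bdot_eq0 mu : bdot E mu mu = 0 -> mu = 0.
Proof.
rewrite bdotE => /eqP h.
have h3 i j k : str mu i j k = 0.
  move: h; rewrite psumr_eq0 => [/allP/(_ i (mem_index_enum _))|? _]; last first.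
    by do 2!apply: sumr_ge0 => ? _; exact: mul_conjC_ge0.
  rewrite psumr_eq0 => [/allP/(_ j (mem_index_enum _))|? _]; last first.
    by apply: sumr_ge0 => ? _; exact: mul_conjC_ge0.
  rewrite psumr_eq0 => [/allP/(_ k (mem_index_enum _))|? _]; last first.
    exact: mul_conjC_ge0.
  by rewrite mul_conjC_eq0 => /eqP.
apply/bilinP => x y.
rewrite (cV_col x Eu) (cV_col y Eu) !bmul_suml; apply: eq_bigr => i _.
rewrite !bmul_sumr; apply: eq_bigr => j _; rewrite !bmulZl !bmulZr; do 2!congr (_ *: _).
rewrite -[LHS](mulKVmx Eu) [invmx E *m _](_ : _ = 0).
  by rewrite mulmx0 bmul0f.
by apply/matrixP => k l; rewrite [l]ord1 [LHS]h3 mxE.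
Qed.

Lemma emxD A B : emx (A + B) = emx A + emx B.
Proof. by rewrite /emx mulmxDr mulmxDl. Qed.

Lemma emxM A B : emx (A *m B) = emx A *m emx B.
Proof. by rewrite /emx !mulmxA mulmxK. Qed.

Lemma emx_inj : injective emx.
Proof.
move=> A B /(congr1 (fun X => E *m X *m invmx E)).
by rewrite /emx !mulmxA !mulmxV // !mul1mx !mulmxK.
Qed.

(** With injectivity of [emx], this reduces the rules for [adj] to those for the conjugate
    transpose. *)
Lemma emx_adj A : emx (adj E A) = (map_mx Num.conj (emx A))^T.
Proof. by rewrite /emx /adj !mulmxA mulVmx // mul1mx mulmxKV. Qed.

Lemma emxZ a A : emx (a *: A) = a *: emx A.
Proof. by rewrite /emx -scalemxAr -scalemxAl. Qed.

Lemma hadjK A : adj E (adj E A) = A.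
Proof.
apply: emx_inj; rewrite [LHS]emx_adj [X in map_mx _ X]emx_adj.
by apply/matrixP=> i j; rewrite !mxE conjCK.
Qed.

Lemma hadjM A B : adj E (A *m B) = adj E B *m adj E A.
Proof.
apply: emx_inj; rewrite [LHS]emx_adj emxM map_mxM trmx_mul [RHS]emxM.
by congr (_ *m _); rewrite [RHS]emx_adj.
Qed.

Lemma hadjD A B : adj E (A + B) = adj E A + adj E B.
Proof.
apply: emx_inj; rewrite [LHS]emx_adj emxD map_mxD linearD [RHS]emxD.
by congr (_ + _); rewrite [RHS]emx_adj.
Qed.

Lemma hadjZ a A : adj E (a *: A) = a^* *: adj E A.
Proof.
apply: emx_inj; rewrite [LHS]emx_adj emxZ map_mxZ linearZ [RHS]emxZ.
by congr (_ *: _); rewrite [RHS]emx_adj.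
Qed.

Lemma hadjB A B : adj E (A - B) = adj E A - adj E B.
Proof. by rewrite -scaleN1r hadjD hadjZ rmorphN1 scaleN1r. Qed.

Lemma hadj_sum (I : finType) (F : I -> 'M[R[i]]_n) :
  adj E (\sum_i F i) = \sum_i adj E (F i).
Proof.
apply: (big_morph (adj E) hadjD); rewrite -[0 in LHS](scale0r 0) hadjZ rmorph0.
by rewrite scale0r.
Qed.

Lemma mxdotE A B : mxdot E A B = \sum_i \sum_j emx A i j * (emx B i j)^*.
Proof.
rewrite /mxdot -[X in \tr X](mulKVmx Eu) mxtrace_mulC -/(emx _) emxM emx_adj.
by apply: eq_bigr => i _; rewrite mxE; apply: eq_bigr => j _; rewrite !mxE.
Qed.

Lemma mxdotBl A B C : mxdot E (A - B) C = mxdot E A C - mxdot E B C.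
Proof. by rewrite /mxdot mulmxBl linearB. Qed.

Lemma mxdotZl a A C : mxdot E (a *: A) C = a * mxdot E A C.
Proof. by rewrite /mxdot -scalemxAl linearZ. Qed.

Lemma mxdotC A B : mxdot E B A = (mxdot E A B)^*.
Proof.
rewrite !mxdotE rmorph_sum; apply: eq_bigr => i _.
rewrite rmorph_sum; apply: eq_bigr => j _.
by rewrite rmorphM /= conjCK mulrC.
Qed.

Lemma mxdot_eq0 A : mxdot E A A = 0 -> A = 0.
Proof.
rewrite mxdotE => /eqP h; apply: emx_inj; rewrite /emx mulmx0 mul0mx -/(emx A).
apply/matrixP => i j; rewrite [RHS]mxE.
move: h; rewrite psumr_eq0 => [/allP/(_ i (mem_index_enum _))|? _]; last first.
  by apply: sumr_ge0 => ? _; exact: mul_conjC_ge0.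
rewrite /= psumr_eq0 => [/allP/(_ j (mem_index_enum _))|? _]; last first.
  exact: mul_conjC_ge0.
by rewrite /= mul_conjC_eq0 => /eqP.
Qed.

Lemma emx_colE A x k j : A *m col j E = x -> emx A k j = (invmx E *m x) k 0.
Proof. by move=> <-; rewrite /emx colE !mulmxA -colE [RHS]mxE. Qed.

(** Read as matrix entries of left and right multiplications, the structure constants turn [bdot]
    into a sum of [mxdot] products. *)
Lemma coef_Lmul mu i j k : str mu i j k = emx (Lmul mu (col i E)) k j.
Proof. by apply/esym/emx_colE; exact: mul_Lmul. Qed.

Lemma coef_Rmul mu i j k : str mu i j k = emx (Rmul mu (col j E)) k i.
Proof. by apply/esym/emx_colE; exact: mul_Rmul. Qed.

Lemma MmxE mu : Mmx E mu = Mpol E mu mu.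
Proof. by rewrite Mpol.unlock !sumrB 2!scalerBr. Qed.

(** Cyclicity of the trace turns the three terms of [Mpol] into [mxdot] products of [A *m L],
    [L *m A] and [R *m A] with the left or right multiplications of [lam]; these are the three terms
    of [ract A mu] paired with [lam]. *)
Lemma trace_MpolM mu lam A : \tr (Mpol E mu lam *m A) = 2 * bdot E (ract A mu) lam.
Proof.
rewrite Mpol.unlock -scalemxAl linearZ mulmx_suml linear_sum /=; congr (_ * _).
rewrite (eq_bigr (fun i => mxdot E (A *m Lmul mu (col i E)) (Lmul lam (col i E))
   - mxdot E (Lmul mu (col i E) *m A) (Lmul lam (col i E))
   - mxdot E (Rmul mu (col i E) *m A) (Rmul lam (col i E)))); last first.
  move=> i _; rewrite 2!mulmxBl 2!linearB /=; congr (_ - _ - _).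
  - by rewrite mxtrace_mulC mulmxA.
  - by rewrite -mulmxA mxtrace_mulC.
  - by rewrite -mulmxA mxtrace_mulC.
rewrite bdotE.
have strE j k i : str (ract A mu) i j k = emx (A *m Lmul mu (col i E)) k j
    - emx (Lmul mu (col i E) *m A) k j - emx (Rmul mu (col j E) *m A) k i.
  (* The two input terms are exchanged to follow the order of the terms in [Mpol]. *)
  have coefB (u v w : 'cV[R[i]]_n) : (invmx E *m (u - v - w)) k 0 =
      (invmx E *m u) k 0 - (invmx E *m w) k 0 - (invmx E *m v) k 0.
    by rewrite 2!mulmxBr 4!mx_linE addrAC.
  apply: (etrans (congr1 (fun v => (invmx E *m v) k 0) (bmul_ract _ _ _ _))).
  apply: (etrans (coefB _ _ _)); congr (_ - _ - _); apply/esym/emx_colE.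
  - by rewrite -mulmxA mul_Lmul.
  - by rewrite -mulmxA mul_Lmul.
  - by rewrite -mulmxA mul_Rmul.
have dotE : \sum_i \sum_j \sum_k str (ract A mu) i j k * (str lam i j k)^* =
    \sum_i \sum_j \sum_k emx (A *m Lmul mu (col i E)) k j * (str lam i j k)^*
  - \sum_i \sum_j \sum_k emx (Lmul mu (col i E) *m A) k j * (str lam i j k)^*
  - \sum_i \sum_j \sum_k emx (Rmul mu (col j E) *m A) k i * (str lam i j k)^*.
  rewrite -!sumrB; apply: eq_bigr => i _; rewrite -!sumrB; apply: eq_bigr => j _.
  by rewrite -!sumrB; apply: eq_bigr => k _; rewrite strE !mulrBl.
rewrite dotE !sumrB; congr (_ - _ - _).
- apply: eq_bigr => i _; rewrite mxdotE exchange_big.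
  by do 2!apply: eq_bigr => ? _; rewrite coef_Lmul.
- apply: eq_bigr => i _; rewrite mxdotE exchange_big.
  by do 2!apply: eq_bigr => ? _; rewrite coef_Lmul.
(* Here the outer index has to be that of the second argument, because [Rmul] fixes that one. *)
- rewrite [RHS]exchange_big; apply: eq_bigr => i _; rewrite mxdotE exchange_big.
  by do 2!apply: eq_bigr => ? _; rewrite coef_Rmul.
Qed.

(** Taking adjoints reverses each product under the sum. On the diagonal this makes [Mmx]
    Hermitian. *)
Lemma adj_Mpol mu lam : adj E (Mpol E mu lam) = Mpol E lam mu.
Proof.
rewrite Mpol.unlock hadjZ rmorph_nat hadj_sum; congr (_ *: _); apply: eq_bigr => i _.
by rewrite 2!hadjB hadjM hadjK hadjM hadjK hadjM hadjK.
Qed.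

Lemma hermitian_Mmx mu : Defs.hermitian E (Mmx E mu).
Proof. by rewrite /Defs.hermitian MmxE adj_Mpol. Qed.

(** Nondegeneracy of the trace pairing: [delta_mx j i] extracts the entry (i, j). *)
Lemma eq_mxtrace_mulmx A B : (forall C, \tr (A *m C) = \tr (B *m C)) -> A = B.
Proof.
move=> h; apply/matrixP => i j.
have e (X : 'M[R[i]]_n) : \tr (X *m delta_mx j i) = X i j.
  rewrite /mxtrace (bigD1 i) //= big1 => [|k ki].
    rewrite addr0 mxE (bigD1 j) //= big1 => [|l lj].
      by rewrite mxE !eqxx mulr1 addr0.
    by rewrite mxE (negbTE lj) mulr0.
  by rewrite mxE big1 // => l _; rewrite mxE (negbTE ki) andbF mulr0.
by rewrite -!e h.
Qed.

(** Read off [trace_MpolM] from the additivity of [ract] and [bdot], without expanding the sum over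
    the basis. *)
Lemma MpolDl mu nu lam : Mpol E (mu + nu) lam = Mpol E mu lam + Mpol E nu lam.
Proof.
apply: eq_mxtrace_mulmx => C; rewrite [in RHS]mulmxDl mxtraceD.
rewrite (trace_MpolM (mu + nu) lam C) (trace_MpolM mu lam C).
by rewrite (trace_MpolM nu lam C) ractD bdotDl mulrDr.
Qed.

Lemma MpolZl a mu lam : Mpol E (a *: mu) lam = a *: Mpol E mu lam.
Proof.
apply: eq_mxtrace_mulmx => C; rewrite -[in RHS]scalemxAl mxtraceZ.
rewrite (trace_MpolM (a *: mu) lam C) (trace_MpolM mu lam C).
by rewrite ractZ bdotZl mulrCA.
Qed.

Lemma MpolDr mu nu lam : Mpol E lam (mu + nu) = Mpol E lam mu + Mpol E lam nu.
Proof. by rewrite -[LHS]adj_Mpol MpolDl hadjD; congr (_ + _); exact: adj_Mpol. Qed.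

Lemma MpolZr a mu lam : Mpol E lam (a *: mu) = a^* *: Mpol E lam mu.
Proof. by rewrite -[LHS]adj_Mpol MpolZl hadjZ; congr (_ *: _); exact: adj_Mpol. Qed.

End HermitianGeometry.

(** * Explicit formulas for two by two matrices *)

Section Matrices2.
Variable R : comNzRingType.
Implicit Types A B : 'M[R]_2.

Lemma det_mx2 A : \det A = A 0 0 * A 1 1 - A 0 1 * A 1 0.
Proof.
rewrite (expand_det_row _ 0) big_ord_recl big_ord1 /cofactor !det_mx11 !mxE /=.
rewrite expr0 mul1r expr1 mulN1r mulrN.
by congr (A _ _ * A _ _ - A _ _ * A _ _); apply: val_inj.
Qed.

Lemma mxtrace2 A : \tr A = A 0 0 + A 1 1.
Proof.
by rewrite /mxtrace big_ord_recl big_ord1; congr (_ + A _ _); apply: val_inj.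
Qed.

Lemma mx2P A B :
  A 0 0 = B 0 0 -> A 0 1 = B 0 1 -> A 1 0 = B 1 0 -> A 1 1 = B 1 1 -> A = B.
Proof.
move=> h00 h01 h10 h11; apply/matrixP => i j.
case: (unliftP 0 i) => [i'|] ->; case: (unliftP 0 j) => [j'|] -> //;
  rewrite ?[i']ord1 ?[j']ord1; [move: h11|move: h10|move: h01];
  by rewrite (_ : 1 = lift 0 0) //; apply: val_inj.
Qed.

End Matrices2.

(** * Real and imaginary parts *)

Section RealPart.
Variable R : realType.
Implicit Types (r : R) (x y : R[i]).

Lemma ReD x y : complex.Re (x + y) = complex.Re x + complex.Re y.
Proof. by case: x y => [a b] [c d]. Qed.

Lemma ImD x y : complex.Im (x + y) = complex.Im x + complex.Im y.
Proof. by case: x y => [a b] [c d]. Qed.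

Lemma Im_realM r x : complex.Im (r%:C%C * x) = r * complex.Im x.
Proof. by case: x => a b /=; rewrite mul0r addr0. Qed.

Lemma Re_mul_conj x : complex.Re (x * x^*) = complex.Re x ^+ 2 + complex.Im x ^+ 2.
Proof. by case: x => a b /=; rewrite mulrN opprK. Qed.

Lemma Re_realM r x : complex.Re (r%:C%C * x) = r * complex.Re x.
Proof. by case: x => a b /=; rewrite mul0r subr0. Qed.

Lemma Re_conjc x : complex.Re x^* = complex.Re x.
Proof. by case: x. Qed.

Lemma real_conj r : (r%:C%C)^* = r%:C%C.
Proof. exact: conjc_real. Qed.

Lemma conj_realE x : x^* = x -> (complex.Re x)%:C%C = x.
Proof. by move/CrealP => h; rewrite RRe_real. Qed.

Lemma mul_conj_realE x : (complex.Re (x * x^*))%:C%C = x * x^*.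
Proof. by apply: conj_realE; rewrite rmorphM /= conjCK mulrC. Qed.

(** Computes the factor |det g|^(-4) in the squared norm, which comes from the scalar
    [(\det g)^-1 ^+ 2] in [act g mu]. *)
Lemma Re_mul_conjVX2 x :
  complex.Re (x^-1 ^+ 2 * (x^-1 ^+ 2)^*) = (complex.Re (x * x^*) ^+ 2)^-1.
Proof.
apply: complexI; rewrite mul_conj_realE fmorphV (rmorphXn (real_complex R)).
rewrite /= mul_conj_realE (rmorphXn Num.conj) (fmorphV Num.conj) -exprMn -invfM.
by rewrite exprVn.
Qed.

End RealPart.

(** * Derivatives of polynomials and quotients on the real line *)

Section RealCalculus.
Variable R : realType.
Implicit Types (f g : R -> R) (p : {poly R}).

(** Differentiation at 0 becomes reading off one coefficient for the polynomial functions of [t]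
    below. *)
Lemma is_derive0_poly f p : (forall t, f t = p.[t]) -> is_derive (0 : R) 1 f p`_1.
Proof.
move=> fp; have -> : f = horner p by apply/funext.
by apply: is_derive_eq; rewrite horner_coef0 coef_deriv.
Qed.

(** Differentiability gives continuity. This supplies the neighbourhood on which the quotient
    formulas for [rho] and [Fn] hold. *)
Lemma is_derive_neq0 f (a df : R) :
  is_derive a 1 f df -> f a != 0 -> \near a, f a != 0.
Proof.
move=> [fd _] fa0; have /derivable1_diffP/differentiable_continuous fc := fd.
exact: cvgr_neq0 fc fa0.
Qed.

(** Both [rho] along 1 + t A and [Fn] along mu + t lam are quotients of this shape. *)
Lemma is_derive_div_sqr f g (a df dg : R) :
    is_derive a 1 f df -> is_derive a 1 g dg -> g a != 0 ->
  is_derive a 1 (fun t => f t / g t ^+ 2) ((df * g a - 2 * f a * dg) / g a ^+ 3).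
Proof.
move=> hf hg ga.
have hg2 : is_derive a 1 (fun t => g t ^+ 2) (2 * g a * dg).
  by apply: is_derive_eq; rewrite /GRing.scale /=; ring.
have hV : is_derive a 1 (fun t => (g t ^+ 2)^-1) (- (g a ^+ 2) ^- 2 *: (2 * g a * dg)).
  by apply: is_deriveV; rewrite expf_neq0.
by apply: is_derive_eq; rewrite /GRing.scale /=; field.
Qed.

End RealCalculus.

(** * The real inner product on bilinear maps of the plane, and inversion in dimension two *)

Section PlaneGeometry.
Variables (R : realType) (E : 'M[R[i]]_2).
Hypothesis Eu : E \in unitmx.
Implicit Types (a : R[i]) (mu lam nu : bilin R 2) (A B C D : 'M[R[i]]_2).

Definition rdot mu lam : R := complex.Re (bdot E mu lam).

Lemma rdotC mu lam : rdot mu lam = rdot lam mu.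
Proof. by rewrite /rdot bdotC // Re_conjc. Qed.

Lemma rdotDl mu nu lam : rdot (mu + nu) lam = rdot mu lam + rdot nu lam.
Proof. by rewrite /rdot bdotDl // ReD. Qed.

Lemma rdotDr mu nu lam : rdot lam (mu + nu) = rdot lam mu + rdot lam nu.
Proof. by rewrite rdotC rdotDl !(rdotC lam). Qed.

Lemma rdotZl (r : R) mu lam : rdot (r%:C%C *: mu) lam = r * rdot mu lam.
Proof. by rewrite /rdot bdotZl // Re_realM. Qed.

Lemma rdotZr (r : R) mu lam : rdot lam (r%:C%C *: mu) = r * rdot lam mu.
Proof. by rewrite rdotC rdotZl rdotC. Qed.

Lemma bdot_sqnorm mu : bdot E mu mu = (sqnorm E mu)%:C%C.
Proof. by rewrite conj_realE // -bdotC. Qed.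

Lemma sqnormZ a mu : sqnorm E (a *: mu) = complex.Re (a * a^*) * sqnorm E mu.
Proof.
rewrite /sqnorm bdotZl // (bdotC Eu (a *: mu) mu) bdotZl // rmorphM /= -bdotC //.
by rewrite mulrA -[in LHS]mul_conj_realE Re_realM.
Qed.

Lemma rdotZ_diag a mu : rdot mu (a *: mu) = complex.Re a * sqnorm E mu.
Proof. by rewrite rdotC /rdot bdotZl // bdot_sqnorm mulrC Re_realM mulrC. Qed.

Lemma sqnorm_gt0 mu : mu != 0 -> 0 < sqnorm E mu.
Proof.
move=> mu0; have := bdot_ge0 Eu mu; rewrite bdot_sqnorm ler0c le_eqVlt.
case/predU1P => // q0; case/eqP: mu0; apply: (bdot_eq0 Eu).
by rewrite bdot_sqnorm -q0.
Qed.

(** By Cayley-Hamilton, [(\tr A)%:M - A] is the adjugate of [A]. *)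
Lemma invmx2 A : A \in unitmx -> invmx A = (\det A)^-1 *: ((\tr A)%:M - A).
Proof.
move=> Au; apply: (can_inj (mulKmx Au)); rewrite mulmxV // -scalemxAr.
have -> : A *m ((\tr A)%:M - A) = (\det A)%:M.
  apply: mx2P; rewrite !mxE !big_ord_recl !big_ord0 !mxE det_mx2 mxtrace2 /=;
  rewrite (_ : lift 0 0 = 1) ?eqxx //=; try exact: val_inj; ring.
by rewrite scale_scalar_mx mulVf //; rewrite unitmxE unitfE in Au.
Qed.

End PlaneGeometry.

(** * Expansion of the action near the identity *)

Section FirstOrderAction.
Variable R : realType.
Implicit Types (a : R[i]) (mu : bilin R 2) (A B C : 'M[R[i]]_2).

(* In dimension 2 the adjugate \tr g - g of g = 1 + a A is affine in a, so that
   (1 + a A).mu is a cubic polynomial in a divided by det (1 + a A)^2. *)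
Lemma act_1D A mu : exists nu2 nu3 : bilin R 2, forall a,
    1%:M + a *: A \in unitmx ->
  act (1%:M + a *: A) mu = (\det (1%:M + a *: A))^-1 ^+ 2 *:
    (mu + a *: (ract A mu + (2 * \tr A) *: mu) + a ^+ 2 *: nu2 + a ^+ 3 *: nu3).
Proof.
(* [B] is the adjugate [(\tr A)%:M - A]; since the adjugate is linear in dimension two, that of 1 +
   a A is 1 + a B. *)
have [B trB Bx] : exists2 B : 'M[R[i]]_2,
    forall a, (\tr (1%:M + a *: A))%:M - (1%:M + a *: A) = 1%:M + a *: B &
    forall z : 'cV[R[i]]_2, B *m z = \tr A *: z - A *m z.
  exists ((\tr A)%:M - A) => [a|z]; last by rewrite mulmxBl mul_scalar_mx.
  by apply: mx2P; rewrite !mxE !mxtrace2 !mxE /=; ring.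
(* The coefficients of degree two and three: [A] in the output and [B] in the inputs occupy two of
   the three slots, or all of them. *)
exists (tact A B 1%:M mu + tact A 1%:M B mu + tact 1%:M B B mu), (tact A B B mu).
move=> a gu; apply/bilinP => x y; rewrite bmul_act invmx2 // trB.
set d : R[i] := _^-1.
have mul1D C (z : 'cV[R[i]]_2) : (1%:M + a *: C) *m z = z + a *: (C *m z).
  by rewrite mulmxDl mul1mx -scalemxAl.
have bmul1D (u v : 'cV[R[i]]_2) : bmul mu (x + a *: u) (y + a *: v) =
    bmul mu x y + a *: (bmul mu u y + bmul mu x v) + a ^+ 2 *: bmul mu u v.
  by rewrite bmulDl !bmulDr !bmulZl !bmulZr; mxring.
have mulA (p q r s : 'cV[R[i]]_2) : A *m (p + a *: (q + r) + a ^+ 2 *: s) =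
    A *m p + a *: (A *m q + A *m r) + a ^+ 2 *: (A *m s).
  by rewrite !mulmxDr -!scalemxAr mulmxDr.
have bl : bmul mu (B *m x) y = \tr A *: bmul mu x y - bmul mu (A *m x) y.
  by rewrite Bx -scaleN1r bmulDl !bmulZl scaleN1r.
have br : bmul mu x (B *m y) = \tr A *: bmul mu x y - bmul mu x (A *m y).
  by rewrite Bx -scaleN1r bmulDr !bmulZr scaleN1r.
have nu1E : bmul (ract A mu + (2 * \tr A) *: mu) x y =
    A *m bmul mu x y + bmul mu (B *m x) y + bmul mu x (B *m y).
  by rewrite bmulDf bmulZf bmul_ract bl br; mxring.
have nu2E : bmul (tact A B 1%:M mu + tact A 1%:M B mu + tact 1%:M B B mu) x y =
    A *m bmul mu (B *m x) y + A *m bmul mu x (B *m y) + bmul mu (B *m x) (B *m y).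
  by rewrite 2!bmulDf 3!bmul_tact !mul1mx.
have rhsE (nu1 nu2 nu3 : bilin R 2) (c : R[i]) :
    bmul (c *: (mu + a *: nu1 + a ^+ 2 *: nu2 + a ^+ 3 *: nu3)) x y =
    c *: (bmul mu x y + a *: bmul nu1 x y + a ^+ 2 *: bmul nu2 x y
          + a ^+ 3 *: bmul nu3 x y).
  by rewrite bmulZf 3!bmulDf 3!bmulZf.
have lhsE C (u v : 'cV[R[i]]_2) :
    bmul mu ((d *: C) *m u) ((d *: C) *m v) = d ^+ 2 *: bmul mu (C *m u) (C *m v).
  by rewrite -2!scalemxAl bmulZl bmulZr scalerA.
rewrite rhsE nu1E nu2E (bmul_tact A B B) lhsE -scalemxAr; congr (_ *: _).
rewrite (mul1D B x) (mul1D B y) bmul1D (mul1D A) mulA.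
mxring.
Qed.

End FirstOrderAction.

(** * Squared norms along curves and the differential of [rho] *)

Section Criticality.
Variables (R : realType) (E : 'M[R[i]]_2).
Hypothesis Eu : E \in unitmx.
Implicit Types (a : R[i]) (mu lam nu : bilin R 2) (A B C D : 'M[R[i]]_2).

Lemma sqnorm_cubic_poly mu nu1 nu2 nu3 (t : R) :
  sqnorm E (mu + t%:C%C *: nu1 + t%:C%C ^+ 2 *: nu2 + t%:C%C ^+ 3 *: nu3) =
  (Poly [:: sqnorm E mu; 2 * rdot E mu nu1; 2 * rdot E mu nu2 + sqnorm E nu1;
    2 * (rdot E mu nu3 + rdot E nu1 nu2); 2 * rdot E nu1 nu3 + sqnorm E nu2;
    2 * rdot E nu2 nu3; sqnorm E nu3]).[t].
Proof.
rewrite horner_Poly /= -!rmorphXn /= -[sqnorm E (_ + _)]/(rdot E _ _).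
rewrite !(rdotDl Eu) !(rdotDr Eu) !(rdotZl Eu) !(rdotZr Eu).
rewrite (rdotC Eu nu1 mu) (rdotC Eu nu2 mu) (rdotC Eu nu3 mu) (rdotC Eu nu2 nu1).
rewrite (rdotC Eu nu3 nu1) (rdotC Eu nu3 nu2).
have sE nu : sqnorm E nu = rdot E nu nu by [].
rewrite !sE.
move: (rdot E mu mu) (rdot E mu nu1) (rdot E mu nu2) (rdot E mu nu3) (rdot E nu1 nu1).
move: (rdot E nu1 nu2) (rdot E nu1 nu3) (rdot E nu2 nu2) (rdot E nu2 nu3) (rdot E nu3 nu3).
by move=> *; ring.
Qed.

Lemma sqnorm_line_poly mu lam (t : R) : sqnorm E (mu + t%:C%C *: lam) =
  (Poly [:: sqnorm E mu; 2 * rdot E mu lam; sqnorm E lam]).[t].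
Proof.
have sE nu : sqnorm E nu = rdot E nu nu by [].
rewrite !sE horner_Poly /= (rdotDl Eu) !(rdotDr Eu) !(rdotZl Eu) !(rdotZr Eu).
rewrite (rdotC Eu lam mu).
move: (rdot E mu mu) (rdot E mu lam) (rdot E lam lam).
by move=> *; ring.
Qed.

(** The number [z] has the shape of det (1 + t A), with [a] the trace and [b] the determinant of
    [A]. *)
Lemma normsq_quadratic_poly (a b : R[i]) (t : R) :
  let z := 1 + t%:C%C * a + t%:C%C ^+ 2 * b in
  complex.Re (z * z^*) =
  (Poly [:: 1; 2 * complex.Re a; complex.Re a ^+ 2 + 2 * complex.Re b + complex.Im a ^+ 2;
    2 * (complex.Re a * complex.Re b + complex.Im a * complex.Im b);
    complex.Re b ^+ 2 + complex.Im b ^+ 2]).[t].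
Proof.
move=> z; rewrite horner_Poly /= Re_mul_conj /z -rmorphXn /= !ReD !ImD !Re_realM !Im_realM /=.
ring.
Qed.

Lemma coef1_Poly (x y : R) s : (Poly [:: x, y & s])`_1 = y.
Proof. by rewrite coef_Poly. Qed.

(** Along 1 + t A, [rho] is [N / f ^+ 2] with [N] the squared norm of a cubic curve and [f] the
    squared modulus of the determinant. The linear term of [N] contains 4 Re (tr A) |mu|^2, which
    the derivative of the denominator cancels. *)
Lemma drhoE mu A : drho E mu A = 2 * rdot E (ract A mu) mu.
Proof.
have [nu2 [nu3 actE]] := act_1D A mu.
set nu1 := ract A mu + (2 * \tr A) *: mu in actE.
pose dt (t : R) := \det (1%:M + t%:C%C *: A).
have dtE t : dt t = 1 + t%:C%C * \tr A + t%:C%C ^+ 2 * \det A.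
  by rewrite /dt !det_mx2 mxtrace2 !mxE /=; ring.
pose f t := complex.Re (dt t * (dt t)^*).
pose N (t : R) :=
  sqnorm E (mu + t%:C%C *: nu1 + t%:C%C ^+ 2 *: nu2 + t%:C%C ^+ 3 *: nu3).
have df : is_derive (0 : R) 1 f (2 * complex.Re (\tr A)).
  have fE t : f t = _ := etrans (congr1 (fun z => complex.Re (z * z^*)) (dtE t))
                                (normsq_quadratic_poly _ _ _).
  by have := is_derive0_poly fE; rewrite coef1_Poly.
have dN : is_derive (0 : R) 1 N (2 * rdot E mu nu1).
  by have := is_derive0_poly (sqnorm_cubic_poly mu nu1 nu2 nu3); rewrite coef1_Poly.
have f0 : f 0 = 1.
  by rewrite /f dtE expr2 !mul0r !addr0 rmorph1 mulr1.
have N0 : N 0 = sqnorm E mu.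
  by rewrite /N sqnorm_cubic_poly horner_coef0 coef_Poly.
have f0N0 : f 0 != 0 by rewrite f0 oner_eq0.
have : is_derive (0 : R) 1 (fun t => rho E mu (1%:M + t%:C%C *: A))
  (2 * rdot E (ract A mu) mu).
  have nu1E : rdot E mu nu1 =
      rdot E (ract A mu) mu + 2 * complex.Re (\tr A) * sqnorm E mu.
    rewrite (rdotDr Eu) (rdotC Eu) (rdotZ_diag Eu); congr (_ + _ * _).
    by rewrite mulr_natl mulr2n ReD -mulr2n mulr_natl.
  apply: near_eq_is_derive (is_derive_eq (is_derive_div_sqr dN df f0N0) _); last first.
    rewrite f0 N0 nu1E; move: (rdot E _ _) (sqnorm _ _) (complex.Re _) => p q r.
    by field.
  (* For singular [g], [invmx g] is [g] itself; the formula is therefore claimed only near 0, where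
     [f] and hence the determinant does not vanish. *)
  have := is_derive_neq0 df f0N0; apply: filterS => t ft.
  have gu : 1%:M + t%:C%C *: A \in unitmx.
    rewrite unitmxE unitfE; apply: contraNneq ft => d0.
    by rewrite /f /dt d0 mul0r.
  have rhoE : rho E mu (1%:M + t%:C%C *: A) =
      complex.Re ((dt t)^-1 ^+ 2 * ((dt t)^-1 ^+ 2)^*) * N t.
    by rewrite /rho (actE _ gu); exact: sqnormZ.
  by rewrite rhoE Re_mul_conjVX2 mulrC.
by case=> _; rewrite -derive1E.
Qed.

End Criticality.

(** * The moment map, its squared norm and the criterion for critical points *)

Section MomentMap.
Variables (R : realType) (E : 'M[R[i]]_2).
Hypothesis Eu : E \in unitmx.
Implicit Types (a : R[i]) (mu lam nu : bilin R 2) (A B C D H : 'M[R[i]]_2).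

Let hermitian A := Defs.hermitian E A.

Lemma sqnorm0 : sqnorm E (0 : bilin R 2) = 0.
Proof. by rewrite -(scale0r (0 : bilin R 2)) sqnormZ // mul0r /= mul0r. Qed.

Lemma mxdot_hermitian A B : hermitian B -> mxdot E A B = \tr (A *m B).
Proof. by rewrite /mxdot => ->. Qed.

Lemma conj_trace_hermitian A B : hermitian A -> hermitian B ->
  (\tr (A *m B))^* = \tr (A *m B).
Proof.
move=> hA hB; rewrite [in RHS]mxtrace_mulC -(mxdot_hermitian A hB).
by rewrite -(mxdot_hermitian B hA); apply/esym/mxdotC.
Qed.

Lemma hermitianB A B : hermitian A -> hermitian B -> hermitian (A - B).
Proof. by rewrite /hermitian /Defs.hermitian => hA hB; rewrite hadjB // hA hB. Qed.

Lemma hermitianZ (r : R) A : hermitian A -> hermitian (r%:C%C *: A).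
Proof. by rewrite /hermitian /Defs.hermitian => hA; rewrite hadjZ // hA real_conj. Qed.

(** [mxdot] is definite, and [A - B] is itself an admissible test matrix. *)
Lemma hermitian_ext A B : hermitian A -> hermitian B ->
  (forall H, hermitian H -> mxdot E A H = mxdot E B H) -> A = B.
Proof.
move=> hA hB eAB; apply/eqP; rewrite -subr_eq0; apply/eqP/(mxdot_eq0 Eu).
by rewrite mxdotBl (eAB _ (hermitianB hA hB)) subrr.
Qed.

Lemma mxdot_Mmx mu A : hermitian A ->
  mxdot E (Mmx E mu) A = (2 * rdot E (ract A mu) mu)%:C%C.
Proof.
move=> hA; have hM : hermitian (Mmx E mu) by exact: hermitian_Mmx.
rewrite mxdot_hermitian // -[LHS]conj_realE ?conj_trace_hermitian //.
congr (_%:C%C); rewrite MmxE trace_MpolM // /rdot mulr_natl mulr2n ReD.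
by rewrite mulr_natl mulr2n.
Qed.

(** The default value of [xget] is excluded by exhibiting the only matrix with the defining
    property: it does not depend on the representative of the line, and a Hermitian matrix is
    determined by its pairings. *)
Lemma moment_mapE mu : mu != 0 ->
  moment_map E (pt mu) = ((sqnorm E mu)^-1)%:C%C *: Mmx E mu.
Proof.
move=> mu0; have q0 := sqnorm_gt0 Eu mu0.
have hM : hermitian (Mmx E mu) by exact: hermitian_Mmx.
have momP A : hermitian A ->
    mxdot E (((sqnorm E mu)^-1)%:C%C *: Mmx E mu) A = (drho E mu A / sqnorm E mu)%:C%C.
  by move=> hA; rewrite mxdotZl mxdot_Mmx // drhoE // mulrC -rmorphM.
apply: xget_unique => [|H [hH momH]].
  split=> [|mu' mu'0 ptE A hA]; first exact: hermitianZ.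
  (* Another representative of the line is [a *: mu]; [drho] and [sqnorm] are both multiplied by
     |a|^2, which cancels. *)
  have [a mu'E] : exists a : R[i], mu' = a *: mu.
    suff [a _ aE] : pt mu mu' by exists a.
    by rewrite ptE; exists 1 => //; rewrite scale1r.
  rewrite (momP A hA); apply: (congr1 (fun r : R => r%:C%C)); rewrite 2!(drhoE Eu).
  have -> : sqnorm E mu' = complex.Re (a * a^*) * sqnorm E mu.
    by rewrite mu'E; exact: sqnormZ.
  have -> : rdot E (ract A mu') mu' =
      complex.Re (a * a^*) * rdot E (ract A mu) mu.
    rewrite mu'E ractZ /rdot (bdotZl Eu) (bdotC Eu (a *: mu)) (bdotZl Eu) rmorphM /=.
    rewrite -(bdotC Eu).
    by rewrite mulrA -[in LHS]mul_conj_realE Re_realM.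
  have s0 : complex.Re (a * a^*) != 0.
    apply: contraNneq mu'0 => s0.
    have /eqP := mul_conj_realE a; rewrite s0 rmorph0 eq_sym mul_conjC_eq0 => /eqP a0.
    by rewrite mu'E a0 scale0r.
  have q0' := lt0r_neq0 q0.
  move: (complex.Re _) (sqnorm _ _) (rdot _ _ _) s0 q0' => s q p s0 q0'.
  by field; apply/andP.
apply: hermitian_ext => // [|A hA]; first exact: hermitianZ.
by rewrite (momH mu mu0 erefl A hA) momP.
Qed.

Lemma FnE mu : mu != 0 ->
  Fn E (pt mu) = complex.Re (\tr (Mmx E mu *m Mmx E mu)) / sqnorm E mu ^+ 2.
Proof.
move=> mu0; rewrite /Fn moment_mapE //.
have hM : hermitian (Mmx E mu) by exact: hermitian_Mmx.
rewrite mxdot_hermitian; last exact: hermitianZ.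
rewrite -scalemxAl -scalemxAr !mxtraceZ !Re_realM.
by rewrite mulrA -invfM -expr2 mulrC.
Qed.

Section CriticalPoint.
Variables (mu : bilin R 2) (c : R) (D : 'M[R[i]]_2).
Hypotheses (mu0 : mu != 0) (MmuE : Mmx E mu = (c%:C%C)%:M + D) (Dmu : derivation mu D).

(** For [A := Mmx E mu] in [trace_MpolM], the infinitesimal action on [mu] is multiplication by - c,
    by [ract_derivation]. *)
Lemma trace_Mpol_Mmx lam :
  complex.Re (\tr (Mpol E mu lam *m Mmx E mu)) = - (2 * c * rdot E mu lam).
Proof.
rewrite trace_MpolM // MmuE ract_derivation // -rmorphN bdotZl //.
rewrite mulr_natl mulr2n ReD Re_realM -/(rdot E mu lam).
by move: (rdot _ _ _) => r; ring.
Qed.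

(** By [adj_Mpol] and hermiticity of [Mmx E mu], the two traces are complex conjugates. *)
Lemma Re_trace_Mpol_swap lam : complex.Re (\tr (Mpol E lam mu *m Mmx E mu)) =
  complex.Re (\tr (Mpol E mu lam *m Mmx E mu)).
Proof.
rewrite -(mxdot_hermitian (Mpol E mu lam) (hermitian_Mmx Eu mu)).
rewrite -[RHS]Re_conjc -mxdotC // -(adj_Mpol Eu mu lam) mxtrace_mulC.
by [].
Qed.

Lemma trace_Mmx2 : complex.Re (\tr (Mmx E mu *m Mmx E mu)) = - (2 * c * sqnorm E mu).
Proof. by rewrite {1}MmxE trace_Mpol_Mmx. Qed.

Lemma Fn_derivation : Fn E (pt mu) = - (2 * c) / sqnorm E mu.
Proof.
rewrite FnE // trace_Mmx2.
have := lt0r_neq0 (sqnorm_gt0 Eu mu0); move: (sqnorm _ _) => q q0.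
by field.
Qed.

(** With q = |mu|^2 and r = Re <mu, lam>, the numerator in [is_derive_div_sqr] is - 8 c r q + 2 (2 c
    q) (2 r) = 0. *)
Lemma critical_point_derivation : critical_point E mu.
Proof.
split=> // lam; pose nu (t : R) := mu + t%:C%C *: lam.
pose M1 := Mpol E mu lam + Mpol E lam mu.
have ME t : Mmx E (nu t) = Mmx E mu + t%:C%C *: M1 + t%:C%C ^+ 2 *: Mmx E lam.
  rewrite !MmxE /nu /M1 MpolDl // !MpolDr // !MpolZl // !MpolZr // real_conj.
  by move: (Mpol _ _ _) (Mpol _ _ _) (Mpol _ _ _) (Mpol _ _ _) => *; mxring.
(* The real trace form is hidden behind an existential, so that its values are atoms and the square
   is expanded by symmetry and bilinearity alone. *)
have [tau tauE] : exists tau : 'M[R[i]]_2 -> 'M[R[i]]_2 -> R,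
    forall A B, tau A B = complex.Re (\tr (A *m B)).
  by exists (fun A B => complex.Re (\tr (A *m B))).
have tauC A B : tau A B = tau B A by rewrite !tauE mxtrace_mulC.
have tauDl A B C : tau (A + B) C = tau A C + tau B C.
  by rewrite !tauE mulmxDl mxtraceD ReD.
have tauZl (r : R) A C : tau (r%:C%C *: A) C = r * tau A C.
  by rewrite !tauE -scalemxAl mxtraceZ Re_realM.
have tauDr A B C : tau C (A + B) = tau C A + tau C B by rewrite tauC tauDl !(tauC C).
have tauZr (r : R) A C : tau C (r%:C%C *: A) = r * tau C A.
  by rewrite tauC tauZl (tauC C).
have tau_quadratic X Y Z (t : R) :
    tau (X + t%:C%C *: Y + t%:C%C ^+ 2 *: Z) (X + t%:C%C *: Y + t%:C%C ^+ 2 *: Z) =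
    (Poly [:: tau X X; 2 * tau Y X; 2 * tau Z X + tau Y Y; 2 * tau Z Y; tau Z Z]).[t].
  rewrite horner_Poly /= -rmorphXn /= 2!tauDl 2!tauZl 6!tauDr 6!tauZr.
  rewrite (tauC X Y) (tauC X Z) (tauC Y Z).
  move: (tau X X) (tau Y X) (tau Z X) (tau Y Y) (tau Z Y) (tau Z Z).
  by move=> *; ring.
have PE (t : R) : tau (Mmx E (nu t)) (Mmx E (nu t)) = _ :=
  etrans (congr1 (fun X => tau X X) (ME t)) (tau_quadratic _ _ _ _).
have QE (t : R) : sqnorm E (nu t) = _ := sqnorm_line_poly Eu mu lam t.
have dP := is_derive0_poly PE; have dQ := is_derive0_poly QE.
rewrite coef1_Poly in dP; rewrite coef1_Poly in dQ.
have nu0 : nu 0 = mu by rewrite /nu rmorph0 scale0r addr0.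
have q0 := lt0r_neq0 (sqnorm_gt0 Eu mu0).
have q0' : sqnorm E (nu 0) != 0 by rewrite nu0.
apply: near_eq_is_derive (is_derive_eq (is_derive_div_sqr dP dQ q0') _); last first.
  have -> : tau M1 (Mmx E mu) = - (4 * c * rdot E mu lam).
    rewrite tauDl !tauE Re_trace_Mpol_swap trace_Mpol_Mmx.
    by move: (rdot _ _ _) => r; ring.
  rewrite nu0 tauE trace_Mmx2.
  move: (sqnorm _ _) (rdot _ _ _) q0 => q r q0.
  by field.
(* Near 0 the squared norm of [nu t] is nonzero, so [nu t] is nonzero and [FnE] applies. *)
have := is_derive_neq0 dQ q0'; apply: filterS => t nut.
have nut0 : nu t != 0.
  by apply: contraNneq nut => ->; rewrite sqnorm0.
by rewrite tauE (FnE nut0).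
Qed.

End CriticalPoint.
End MomentMap.

(** * Classification of the two-dimensional symmetric Leibniz algebras *)

Section Classification.
Variable R : realType.
Implicit Types (a : R[i]) (mu lam : bilin R 2) (x y z : 'cV[R[i]]_2) (A B C D P : 'M[R[i]]_2).

Lemma sum_ord2 (V : nmodType) (F : 'I_2 -> V) : \sum_i F i = F 0 + F 1.
Proof. by rewrite big_ord_recl big_ord1; congr (_ + F _); apply: val_inj. Qed.

Lemma ord2P (Q : 'I_2 -> Prop) : Q 0 -> Q 1 -> forall i, Q i.
Proof.
move=> Q0 Q1 i; case: (unliftP 0 i) => [j|] -> //.
by rewrite (_ : lift 0 j = 1) //; apply: val_inj; rewrite [j]ord1.
Qed.

Lemma cV2P x y : x 0 0 = y 0 0 -> x 1 0 = y 1 0 -> x = y.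
Proof.
by move=> h0 h1; apply/matrixP => i j; rewrite [j]ord1; elim/ord2P: i.
Qed.

(** Written through the coordinates of basis vectors so that [bmul_ffun] applies; the coefficient is
    the determinant of [x] and [y]. *)
Definition lie2 : bilin R 2 := [ffun ij =>
  let x := delta_mx ij.1 0 : 'cV_2 in let y := delta_mx ij.2 0 : 'cV_2 in
  (x 0 0 * y 1 0 - x 1 0 * y 0 0) *: delta_mx 1 0].

Definition nil2 : bilin R 2 := [ffun ij =>
  let x := delta_mx ij.1 0 : 'cV_2 in let y := delta_mx ij.2 0 : 'cV_2 in
  (x 0 0 * y 0 0) *: delta_mx 1 0].

Lemma bmul_lie2 x y :
  bmul lie2 x y = (x 0 0 * y 1 0 - x 1 0 * y 0 0) *: delta_mx 1 0.
Proof.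
apply: (bmul_ffun (f := fun x y =>
    (x 0 0 * y 1 0 - x 1 0 * y 0 0) *: delta_mx 1 0 : 'cV[R[i]]_2)) => u a v w;
  by apply: cV2P; rewrite !mxE /=; ring.
Qed.

Lemma bmul_nil2 x y : bmul nil2 x y = (x 0 0 * y 0 0) *: delta_mx 1 0.
Proof.
apply: (bmul_ffun (f := fun x y =>
    (x 0 0 * y 0 0) *: delta_mx 1 0 : 'cV[R[i]]_2)) => u a v w;
  by apply: cV2P; rewrite !mxE /=; ring.
Qed.

Lemma symmetric_leibniz_lie2 : symmetric_leibniz lie2.
Proof.
by move=> x y z; split; rewrite !bmul_lie2; apply: cV2P; rewrite !mxE /=; ring.
Qed.

Lemma symmetric_leibniz_nil2 : symmetric_leibniz nil2.
Proof.
by move=> x y z; split; rewrite !bmul_nil2; apply: cV2P; rewrite !mxE /=; ring.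
Qed.

Lemma lie_algebra_lie2 : lie_algebra lie2.
Proof.
split=> [x|x y z]; rewrite !bmul_lie2; apply: cV2P; rewrite !mxE /=; ring.
Qed.

Definition cols x y : 'M[R[i]]_2 := \matrix_(i, j) if j == 0 then x i 0 else y i 0.

Lemma col0_cols x y : col 0 (cols x y) = x.
Proof. by apply/matrixP => i j; rewrite [j]ord1 !mxE. Qed.

Lemma col1_cols x y : col 1 (cols x y) = y.
Proof. by apply/matrixP => i j; rewrite [j]ord1 !mxE. Qed.

Lemma cols_unit x y : x 0 0 * y 1 0 - x 1 0 * y 0 0 != 0 -> cols x y \in unitmx.
Proof. by rewrite unitmxE unitfE det_mx2 !mxE /= [y 0 0 * _]mulrC. Qed.

Lemma parallel_cols x y : x != 0 -> x 0 0 * y 1 0 - x 1 0 * y 0 0 = 0 ->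
  exists a, y = a *: x.
Proof.
move=> x0 d0; have [x00|x00] := eqVneq (x 0 0) 0.
  have x10 : x 1 0 != 0.
    apply: contraNneq x0 => x10; apply/eqP/cV2P; by rewrite mxE.
  exists (y 1 0 / x 1 0); apply: cV2P; rewrite !mxE; last by rewrite divfK.
  move/eqP: d0; rewrite x00 mul0r sub0r oppr_eq0 mulf_eq0 (negbTE x10) /= => /eqP ->.
  by rewrite mulr0.
exists (y 0 0 / x 0 0); apply: cV2P; rewrite !mxE; first by rewrite divfK.
by apply: (mulfI x00); rewrite (subr0_eq d0); field.
Qed.

(** The isomorphism is [invmx P], the passage to coordinates in the basis of columns of [P]. *)
Lemma isomorphic_basis mu lam P : P \in unitmx ->
    (forall i j, bmul mu (col i P) (col j P) = P *m lam (i, j)) ->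
  isomorphic mu lam.
Proof.
move=> Pu h; exists (invmx P) => [|x y]; first by rewrite unitmx_inv.
rewrite {1}(cV_col x Pu) bmul_suml mulmx_sumr; apply: eq_bigr => i _.
rewrite {1}(cV_col y Pu) bmul_sumr mulmx_sumr; apply: eq_bigr => j _.
by rewrite bmulZl bmulZr h scalerA -scalemxAr mulKmx.
Qed.

Lemma isomorphic_nil2 mu x :
  symmetric_leibniz mu -> bmul mu x x != 0 -> isomorphic mu nil2.
Proof.
move=> smu; set y := bmul mu x x => y0.
(* The first identity at (x, x, x) reads xy = yx + xy. *)
have yx : bmul mu y x = 0.
  have [h _] := smu x x x; rewrite -/y in h.
  by apply: (addIr (bmul mu x y)); rewrite -h add0r.
(* The second identity at (x, x, x) reads yx = yx + xy. *)
have xy : bmul mu x y = 0.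
  have [_ h] := smu x x x; rewrite -/y in h.
  by apply: (addrI (bmul mu y x)); rewrite -h addr0.
(* The first identity at (y, x, x) reads yy = (yx)x + x(yx). *)
have yy : bmul mu y y = 0.
  have [h _] := smu y x x; rewrite -/y yx in h.
  by rewrite h bmul0l bmul0r addr0.
have x0 : x != 0 by apply: contraNneq y0 => x0; rewrite /y x0 bmul0l.
have Pu : cols x y \in unitmx.
  (* If y = a x, then a y = x (a x) = xy = 0, so [a] and with it [y] vanishes. *)
  apply: cols_unit; apply/eqP => d0; have [a ya] := parallel_cols x0 d0.
  have /eqP : a *: y = 0 by rewrite -bmulZr -ya.
  by rewrite scaler_eq0 (negbTE y0) orbF => /eqP a0; rewrite ya a0 scale0r eqxx in y0.
apply: (isomorphic_basis Pu); apply: ord2P; apply: ord2P;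
  rewrite ?col0_cols ?col1_cols -[in RHS]bmul_delta bmul_nil2 !mxE /=.
- by rewrite mulr1 scale1r -colE col1_cols.
- by rewrite mulr0 scale0r mulmx0.
- by rewrite mul0r scale0r mulmx0.
- by rewrite mul0r scale0r mulmx0.
Qed.

Lemma bmul_alternating mu x y : (forall z, bmul mu z z = 0) ->
  bmul mu x y = (x 0 0 * y 1 0 - x 1 0 * y 0 0) *: mu (0, 1).
Proof.
move=> alt.
have m00 : mu (0, 0) = 0 by rewrite -bmul_delta.
have m11 : mu (1, 1) = 0 by rewrite -bmul_delta.
have m10 : mu (1, 0) = - mu (0, 1).
  have := alt (delta_mx 0 0 + delta_mx 1 0).
  rewrite bmulDl !bmulDr !bmul_delta m00 m11 add0r addr0 addrC => h.
  by apply/eqP; rewrite -addr_eq0 h.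
rewrite /bmul !sum_ord2 m00 m11 m10; mxring.
Qed.

(** The product is det(x, y) w, so an [x] with det(x, w) = 1 satisfies xw = w, and (x, w) is a basis
    with the table of [lie2]. *)
Lemma isomorphic_lie2 mu :
  (forall x, bmul mu x x = 0) -> mu != 0 -> isomorphic mu lie2.
Proof.
move=> alt mu0; set w := mu (0, 1).
have muE x y := bmul_alternating x y alt.
have w0 : w != 0.
  apply: contraNneq mu0 => w0; apply/eqP/bilinP => x y.
  by rewrite muE -/w w0 scaler0 bmul0f.
have [x dx] : exists x : 'cV[R[i]]_2, x 0 0 * w 1 0 - x 1 0 * w 0 0 = 1.
  have [w00|w00] := eqVneq (w 0 0) 0; last first.
    exists (- (w 0 0)^-1 *: delta_mx 1 0).
    by rewrite !mxE /= mulr0 mul0r mulr1 sub0r mulNr opprK mulVf.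
  have w10 : w 1 0 != 0.
    by apply: contraNneq w0 => w10; apply/eqP/cV2P; rewrite mxE.
  exists ((w 1 0)^-1 *: delta_mx 0 0).
  by rewrite !mxE /= mulr0 mul0r mulr1 subr0 mulVf.
have Pu : cols x w \in unitmx by apply: cols_unit; rewrite dx oner_eq0.
have xw : bmul mu x w = w by rewrite muE dx scale1r.
have wx : bmul mu w x = - w.
  by rewrite muE -[LHS]opprK -scaleNr opprB [_ * _ - _]addrC; rewrite [w 1 0 * _]mulrC
   [w 0 0 * _]mulrC addrC dx scale1r.
apply: (isomorphic_basis Pu); apply: ord2P; apply: ord2P;
  rewrite ?col0_cols ?col1_cols -[in RHS]bmul_delta bmul_lie2 !mxE /=
    ?(alt, xw, wx) ?(mulr0, mul0r, mulr1) ?(subr0, subrr, sub0r) ?scale0r ?mulmx0 //.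
- by rewrite scale1r -colE col1_cols.
- by rewrite scaleN1r mulmxN -colE col1_cols.
Qed.

Lemma isomorphic_trans mu lam nu :
  isomorphic mu lam -> isomorphic lam nu -> isomorphic mu nu.
Proof.
move=> [g gu gP] [h hu hP]; exists (h *m g) => [|x y]; first by rewrite unitmx_mul hu.
by rewrite -!mulmxA gP hP.
Qed.

Lemma symmetric_leibniz_classification mu : symmetric_leibniz mu -> mu != 0 ->
  isomorphic mu lie2 \/ isomorphic mu nil2.
Proof.
move=> smu mu0; have [[x xx]|alt] := pselect (exists x, bmul mu x x != 0).
  by right; exact: isomorphic_nil2 xx.
left; apply: isomorphic_lie2 => // x; apply/eqP; apply: contra_notT alt => xx.
by exists x.
Qed.

End Classification.

(** * Transport of structures along [E] *)

Section ChangeOfBasis.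
Variables (R : realType) (n : nat) (E : 'M[R[i]]_n).
Hypothesis Eu : E \in unitmx.
Implicit Types (mu lam : bilin R n) (x y z : 'cV[R[i]]_n) (A D : 'M[R[i]]_n).

Lemma symmetric_leibniz_act mu : symmetric_leibniz mu -> symmetric_leibniz (act E mu).
Proof.
move=> smu x y z; rewrite !bmul_act !mulKmx //.
have [h1 h2] := smu (invmx E *m x) (invmx E *m y) (invmx E *m z).
by rewrite -!mulmxDr; split; congr (_ *m _).
Qed.

Lemma lie_algebra_act mu : lie_algebra mu -> lie_algebra (act E mu).
Proof.
move=> [alt jac]; split=> [x|x y z]; first by rewrite bmul_act alt mulmx0.
by rewrite !bmul_act !mulKmx // -!mulmxDr jac mulmx0.
Qed.

(** The vanishing of all squares is the invariant that separates the two algebras. *)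
Lemma isomorphic_alternating mu lam : isomorphic mu lam ->
  (forall x, bmul mu x x = 0) -> forall x, bmul lam x x = 0.
Proof.
by move=> [g gu gP] alt x; rewrite -[x](mulKVmx gu) -gP alt mulmx0.
Qed.

Lemma derivation_act mu D :
  derivation mu D -> derivation (act E mu) (E *m D *m invmx E).
Proof.
move=> dD x y; rewrite !bmul_act.
have invD z : invmx E *m (E *m D *m invmx E *m z) = D *m (invmx E *m z).
  by rewrite -!mulmxA mulKmx.
by rewrite !invD -mulmxDr -dD -!mulmxA mulKmx.
Qed.

Lemma bmul_act_col mu i j : bmul (act E mu) (col i E) (col j E) = E *m mu (i, j).
Proof. by rewrite bmul_act !colE !mulKmx // bmul_delta. Qed.

Lemma hadj_id A : adj 1%:M A = (map_mx Num.conj A)^T.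
Proof. by rewrite /adj invmx1 !mul1mx !mulmx1. Qed.

Lemma adj_conjugate A : adj E (E *m A *m invmx E) = E *m adj 1%:M A *m invmx E.
Proof.
rewrite hadj_id /adj; congr (_ *m (map_mx _ _)^T *m _).
by rewrite !mulmxA mulVmx // mul1mx mulmxKV.
Qed.

Lemma Lmul_act mu i :
  Lmul (act E mu) (col i E) = E *m Lmul mu (col i 1%:M) *m invmx E.
Proof.
apply/matrixP => k j; rewrite mxE bmul_act !colE mul1mx mulKmx // -mul_Lmul !mulmxA.
by rewrite -colE mxE.
Qed.

Lemma Rmul_act mu i :
  Rmul (act E mu) (col i E) = E *m Rmul mu (col i 1%:M) *m invmx E.
Proof.
apply/matrixP => k j; rewrite mxE bmul_act !colE mul1mx mulKmx // -mul_Rmul !mulmxA.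
by rewrite -colE mxE.
Qed.

(** [E] sends the standard basis to the orthonormal basis of its columns, so multiplications and
    adjoints are all conjugated by it. This reduces the computation to the standard inner
    product. *)
Lemma Mmx_act mu : Mmx E (act E mu) = E *m Mmx 1%:M mu *m invmx E.
Proof.
have conjM A B : E *m A *m invmx E *m (E *m B *m invmx E) = E *m (A *m B) *m invmx E.
  by rewrite !mulmxA mulmxKV.
have conjB X Y : E *m (X - Y) *m invmx E = E *m X *m invmx E - E *m Y *m invmx E.
  by rewrite mulmxBr mulmxBl.
have conj_sum (F : 'I_n -> 'M[R[i]]_n) :
    E *m (2 *: \sum_i F i) *m invmx E = 2 *: \sum_i (E *m F i *m invmx E).
  by rewrite -scalemxAr -scalemxAl mulmx_sumr mulmx_suml.
apply: (etrans _ (esym (etrans (conjB _ _) (congr1 (fun X => X - _) (conjB _ _))))).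
congr (_ - _ - _); apply: (etrans _ (esym (conj_sum _))); congr (_ *: _);
  apply: eq_bigr => i _.
- by rewrite Lmul_act adj_conjugate conjM.
- by rewrite Lmul_act adj_conjugate conjM.
- by rewrite Rmul_act adj_conjugate conjM.
Qed.

(** The structure constants of [act E mu] in the columns of [E] are those of [mu] in the standard
    basis. *)
Lemma sqnorm_act mu : sqnorm E (act E mu) =
  complex.Re (\sum_i \sum_j \sum_k mu (i, j) k 0 * (mu (i, j) k 0)^*).
Proof.
rewrite /sqnorm bdotE //; congr complex.Re; do 3!apply: eq_bigr => ? _.
by rewrite bmul_act_col mulKmx.
Qed.

Lemma char_poly_conjugate A : char_poly (E *m A *m invmx E) = char_poly A.
Proof.
rewrite /char_poly /char_poly_mx.
pose f (X : 'M[R[i]]_n) := map_mx (@polyC R[i]) X.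
have fE : f E *m f (invmx E) = 1%:M by rewrite -map_mxM mulmxV // map_mx1.
have -> : 'X%:M - f (E *m A *m invmx E) = f E *m ('X%:M - f A) *m f (invmx E).
  rewrite mulmxBr mulmxBl scalar_mxC -[X in _ = X - _]mulmxA fE mulmx1.
  by rewrite /f !map_mxM.
rewrite !det_mulmx mulrAC -det_mulmx fE det1 mul1r //.
Qed.

End ChangeOfBasis.

(** * Moment matrices and derivations of the two algebras *)

Section Examples.
Variable R : realType.

Lemma Lmul_lie2 : Lmul (lie2 R) (col 0 1%:M) = delta_mx 1 1 /\
  Lmul (lie2 R) (col 1 1%:M) = - delta_mx 1 0.
Proof. by split; apply: mx2P; rewrite !mxE bmul_lie2 !mxE /=; ring. Qed.

Lemma Rmul_lie2 : Rmul (lie2 R) (col 0 1%:M) = - delta_mx 1 1 /\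
  Rmul (lie2 R) (col 1 1%:M) = delta_mx 1 0.
Proof. by split; apply: mx2P; rewrite !mxE bmul_lie2 !mxE /=; ring. Qed.

Lemma Lmul_nil2 : Lmul (nil2 R) (col 0 1%:M) = delta_mx 1 0 /\
  Lmul (nil2 R) (col 1 1%:M) = 0.
Proof. by split; apply: mx2P; rewrite !mxE bmul_nil2 !mxE /=; ring. Qed.

Lemma Rmul_nil2 : Rmul (nil2 R) (col 0 1%:M) = delta_mx 1 0 /\
  Rmul (nil2 R) (col 1 1%:M) = 0.
Proof. by split; apply: mx2P; rewrite !mxE bmul_nil2 !mxE /=; ring. Qed.

Lemma hadj_id_delta n (i j : 'I_n) : adj 1%:M (delta_mx i j : 'M[R[i]]_n) = delta_mx j i.
Proof. by rewrite hadj_id map_delta_mx trmx_delta. Qed.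

Lemma hadj_idN n (A : 'M[R[i]]_n) : adj 1%:M (- A) = - adj 1%:M A.
Proof. by rewrite !hadj_id map_mxN linearN. Qed.

Lemma hadj_id0 n : adj 1%:M (0 : 'M[R[i]]_n) = 0.
Proof. by rewrite hadj_id map_mx0 trmx0. Qed.

(** diag(0, 1) here and diag(1, 2) next: the derivation parts of the two moment matrices, rescaled
    to coprime integer eigenvalues. *)
Definition Dlie2 : 'M[R[i]]_2 := delta_mx 1 1.
Definition Dnil2 : 'M[R[i]]_2 := delta_mx 0 0 + 2 *: delta_mx 1 1.

(** The matrix is diag(-4, 0). A derivation diag(s, t) must satisfy t = s + t, hence s = 0, c = -4
    and t = 4. *)
Lemma Mmx_lie2 : Mmx 1%:M (lie2 R) = ((- 4 : R)%:C%C)%:M + (4 : R)%:C%C *: Dlie2.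
Proof.
have [L0 L1] := Lmul_lie2; have [R0 R1] := Rmul_lie2.
rewrite /Mmx !sum_ord2 L0 L1 R0 R1 !hadj_idN !hadj_id_delta !mulNmx !mulmxN !opprK.
rewrite !mul_delta_mx rmorphN rmorph_nat.
by apply: mx2P; rewrite !mxE /=; ring.
Qed.

(** The matrix is diag(-4, 2). A derivation diag(s, t) must satisfy t = 2 s; then c + s = -4 and c +
    2 s = 2 give s = 6 and c = -10. *)
Lemma Mmx_nil2 : Mmx 1%:M (nil2 R) = ((- 10 : R)%:C%C)%:M + (6 : R)%:C%C *: Dnil2.
Proof.
have [L0 L1] := Lmul_nil2; have [R0 R1] := Rmul_nil2.
rewrite /Mmx !sum_ord2 L0 L1 R0 R1 !hadj_id0 !hadj_id_delta !mulmx0 !addr0.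
rewrite !mul_delta_mx rmorphN !rmorph_nat.
by apply: mx2P; rewrite !mxE /=; ring.
Qed.

Lemma derivation_lie2 (a : R[i]) : derivation (lie2 R) (a *: Dlie2).
Proof.
move=> x y; rewrite !bmul_lie2 -!scalemxAl.
by apply: cV2P; rewrite !(mxE, sum_ord2) /=; ring.
Qed.

Lemma derivation_nil2 (a : R[i]) : derivation (nil2 R) (a *: Dnil2).
Proof.
move=> x y; rewrite !bmul_nil2 -!scalemxAl.
by apply: cV2P; rewrite !(mxE, sum_ord2) /=; ring.
Qed.

Lemma prod_zip2 (k l : int) :
  \prod_(kd <- zip [:: k; l] [:: 1%N; 1%N]) ('X - (kd.1%:~R)%:P) ^+ kd.2 =
  ('X - (k%:~R)%:P) * ('X - (l%:~R)%:P) :> {poly R[i]}.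
Proof. by rewrite 2!big_cons big_nil mulr1. Qed.

Lemma char_poly_Dlie2 : char_poly Dlie2 = ('X - (0%:~R)%:P) * ('X - (1%:~R)%:P).
Proof.
rewrite /char_poly det_mx2 !mxE /= !polyC0 polyC1; move: ('X : {poly R[i]}) => X.
by ring.
Qed.

Lemma char_poly_Dnil2 : char_poly Dnil2 = ('X - (1%:~R)%:P) * ('X - (2%:~R)%:P).
Proof.
rewrite /char_poly det_mx2 !mxE /= !(mulr0, mulr1, addr0, add0r, polyC0).
move: ('X : {poly R[i]}) => X.
by rewrite polyC1; ring.
Qed.

End Examples.

(** * Types and critical values for an arbitrary inner product *)

Section Final.
Variables (R : realType) (E : 'M[R[i]]_2).
Hypothesis Eu : E \in unitmx.

Lemma has_type_act (mu : bilin R 2) (c a : R) (D : 'M[R[i]]_2) ks ds :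
    act E mu != 0 -> 0 < a ->
    Mmx 1%:M mu = (c%:C%C)%:M + a%:C%C *: D -> derivation mu (a%:C%C *: D) ->
    [/\ size ks = size ds, sorted <%R ks, all (leq 1) ds & \big[gcdz/0]_(k <- ks) k <= 1] ->
    char_poly D = \prod_(kd <- zip ks ds) ('X - (kd.1%:~R)%:P) ^+ kd.2 ->
  [/\ critical_point E (act E mu), has_type E (act E mu) ks ds &
      Fn E (pt (act E mu)) = - (2 * c) / sqnorm E (act E mu)].
Proof.
move=> mu0 a0 ME dD [sz so al gc] ch.
have MEE : Mmx E (act E mu) = (c%:C%C)%:M + E *m (a%:C%C *: D) *m invmx E.
  rewrite Mmx_act // ME mulmxDr mulmxDl; congr (_ + _).
  by rewrite scalar_mxC mulmxK.
have dDE := derivation_act Eu dD.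
have crit : critical_point E (act E mu) by exact: critical_point_derivation MEE dDE.
split=> //; last by exact: Fn_derivation MEE dDE.
(* Scaling by [a^-1] brings the derivation part back to a conjugate of [D], which has the prescribed
   characteristic polynomial. *)
split=> //; exists c, (E *m (a%:C%C *: D) *m invmx E), a^-1; split=> //.
  by rewrite invr_gt0.
split=> //; rewrite -scalemxAr -scalemxAl scalerA -rmorphM mulVf ?lt0r_neq0 //.
by rewrite rmorph1 scale1r char_poly_conjugate.
Qed.

Lemma sqnorm_lie2 : sqnorm E (act E (lie2 R)) = 2.
Proof.
rewrite sqnorm_act // [X in complex.Re X](_ : _ = (2 : R)%:C%C) // rmorph_nat.
rewrite !sum_ord2 -!bmul_delta !bmul_lie2 !mxE /=.
by rewrite !(mulr0, mul0r, mulr1, subr0, sub0r, rmorph0, rmorph1, rmorphN1); ring.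
Qed.

Lemma sqnorm_nil2 : sqnorm E (act E (nil2 R)) = 1.
Proof.
rewrite sqnorm_act // [X in complex.Re X](_ : _ = (1 : R)%:C%C) // rmorph1.
rewrite !sum_ord2 -!bmul_delta !bmul_nil2 !mxE /=.
by rewrite !(mulr0, mul0r, mulr1, rmorph0, rmorph1); ring.
Qed.

End Final.

Theorem mainTheorem9 (R : realType) (E : 'M[R[i]]_2) (hE : E \in unitmx) :
  let e1 := col 0 E in
  let e2 := col 1 E in
  exists muL muN : bilin R 2,
    [/\ (* the two multiplication tables in the basis e1, e2 *)
        [/\ bmul muL e1 e1 = 0, bmul muL e1 e2 = e2,
            bmul muL e2 e1 = - e2 & bmul muL e2 e2 = 0],
        [/\ bmul muN e1 e1 = e2, bmul muN e1 e2 = 0,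
            bmul muN e2 e1 = 0 & bmul muN e2 e2 = 0],
        (* classification up to isomorphism *)
        [/\ [/\ symmetric_leibniz muL, muL != 0 & lie_algebra muL],
            [/\ symmetric_leibniz muN, muN != 0 & ~ lie_algebra muN],
            ~ isomorphic muL muN &
            forall mu : bilin R 2, symmetric_leibniz mu -> mu != 0 ->
              isomorphic mu muL \/ isomorphic mu muN],
        (* the inner product is the one with e1, e2 orthonormal *)
        [/\ critical_point E muL, has_type E muL [:: 0; 1] [:: 1%N; 1%N] &
            Fn E (pt muL) = 4] &
        [/\ critical_point E muN, has_type E muN [:: 1; 2] [:: 1%N; 1%N] &
            Fn E (pt muN) = 20]].
Proof.
(* The standard algebras are transported by [E], so that their tables hold in the orthonormal basis
   [e1], [e2]. *)
move=> e1 e2; exists (act E (lie2 R)), (act E (nil2 R)).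
have lieE i j : bmul (act E (lie2 R)) (col i E) (col j E) =
    bmul (lie2 R) (delta_mx i 0) (delta_mx j 0) 1 0 *: e2.
  rewrite bmul_act_col // -bmul_delta bmul_lie2 -scalemxAr -colE.
  by rewrite mx_linE [delta_mx 1 0 1 0]mxE mulr1.
have nilE i j : bmul (act E (nil2 R)) (col i E) (col j E) =
    bmul (nil2 R) (delta_mx i 0) (delta_mx j 0) 1 0 *: e2.
  rewrite bmul_act_col // -bmul_delta bmul_nil2 -scalemxAr -colE.
  by rewrite mx_linE [delta_mx 1 0 1 0]mxE mulr1.
have e2_neq0 : e2 != 0.
  apply/eqP => e20; have : (delta_mx 1 0 : 'cV[R[i]]_2) = 0.
    by rewrite -(mulKmx hE (delta_mx 1 0)) -colE -/e2 e20 mulmx0.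
  by move/matrixP/(_ 1 0)/eqP; rewrite !mxE oner_eq0.
have tabL : [/\ bmul (act E (lie2 R)) e1 e1 = 0, bmul (act E (lie2 R)) e1 e2 = e2,
    bmul (act E (lie2 R)) e2 e1 = - e2 & bmul (act E (lie2 R)) e2 e2 = 0].
  by split; rewrite lieE bmul_lie2 !mxE /= ?(mulr1, mulr0, mul0r)
    ?(subr0, sub0r, subrr) ?(mul1r, mul0r, mulNr) ?(scale1r, scaleN1r, scale0r).
have tabN : [/\ bmul (act E (nil2 R)) e1 e1 = e2, bmul (act E (nil2 R)) e1 e2 = 0,
    bmul (act E (nil2 R)) e2 e1 = 0 & bmul (act E (nil2 R)) e2 e2 = 0].
  by split; rewrite nilE bmul_nil2 !mxE /= !(mulr1, mulr0, mul0r) ?(scale1r, scale0r).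
have actL0 : act E (lie2 R) != 0.
  apply: contraNneq e2_neq0 => L0; case: tabL => _ <- _ _.
  by rewrite L0 bmul0f.
have actN0 : act E (nil2 R) != 0.
  apply: contraNneq e2_neq0 => N0; case: tabN => <- _ _ _.
  by rewrite N0 bmul0f.
(* The square of [e1] is [e2], which is nonzero; this excludes both a Lie structure on the second
   algebra and an isomorphism from the first. *)
have not_alt : ~ (forall x, bmul (act E (nil2 R)) x x = 0).
  by move=> alt; case/eqP: e2_neq0; case: tabN => <- _ _ _; exact: alt.
have lieL : lie_algebra (act E (lie2 R)).
  by apply: lie_algebra_act; [exact: hE | exact: lie_algebra_lie2].
have leibnizL : symmetric_leibniz (act E (lie2 R)).
  by apply: symmetric_leibniz_act; [exact: hE | exact: symmetric_leibniz_lie2].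
have leibnizN : symmetric_leibniz (act E (nil2 R)).
  by apply: symmetric_leibniz_act; [exact: hE | exact: symmetric_leibniz_nil2].
split; [exact: tabL | exact: tabN | | | ].
- split.
  + by split.
  + by split; [exact: leibnizN | exact: actN0 | case=> alt _; exact: not_alt].
  + move=> iso; apply: not_alt; exact: isomorphic_alternating iso lieL.1.
  + move=> mu smu mu0; have [iso|iso] := symmetric_leibniz_classification smu mu0.
      by left; apply: isomorphic_trans iso _; exact: isomorphic_act.
    by right; apply: isomorphic_trans iso _; exact: isomorphic_act.
- have ksds : [/\ size [:: 0; 1 : int] = size [:: 1%N; 1%N], sorted <%R [:: 0; 1 : int],
      all (leq 1) [:: 1%N; 1%N] & \big[gcdz/0]_(k <- [:: 0; 1 : int]) k <= 1].
    by rewrite !big_cons big_nil.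
  have ch : char_poly (Dlie2 R) = \prod_(kd <- zip [:: 0; 1 : int] [:: 1%N; 1%N])
      ('X - (kd.1%:~R)%:P) ^+ kd.2.
    exact: etrans (char_poly_Dlie2 R) (esym (prod_zip2 R 0 1)).
  (* Here c = -4, a = 4 and the squared norm is 2, so the value is 8 / 2 = 4. *)
  have [crit type ->] := has_type_act hE actL0 (ltr0n R 4) (Mmx_lie2 R)
    (@derivation_lie2 R _) ksds ch.
  by split; [exact: crit | exact: type | rewrite (sqnorm_lie2 hE); field].
- have ksds : [/\ size [:: 1; 2 : int] = size [:: 1%N; 1%N], sorted <%R [:: 1; 2 : int],
      all (leq 1) [:: 1%N; 1%N] & \big[gcdz/0]_(k <- [:: 1; 2 : int]) k <= 1].
    by rewrite !big_cons big_nil.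
  have ch : char_poly (Dnil2 R) = \prod_(kd <- zip [:: 1; 2 : int] [:: 1%N; 1%N])
      ('X - (kd.1%:~R)%:P) ^+ kd.2.
    exact: etrans (char_poly_Dnil2 R) (esym (prod_zip2 R 1 2)).
  (* Here c = -10, a = 6 and the squared norm is 1, so the value is 20. *)
  have [crit type ->] := has_type_act hE actN0 (ltr0n R 6) (Mmx_nil2 R)
    (@derivation_nil2 R _) ksds ch.
  by split; [exact: crit | exact: type | rewrite (sqnorm_nil2 hE); field].
Qed.
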